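(* Let $\alpha\in(0,1]$ and let $a_\alpha^{\min},a_\alpha^{\max}$ be the smallest and largest eigenvalues of $\mathbf A_\alpha$ (which are real and positive). For any fixed $c_1\in\mathbb R$, the function $c_{23}\mapsto \bar r(c_1,c_{23})$ on $\mathbb R$ is minimized at $$c_{23}^*=\frac{2(1+c_1)}{a_\alpha^{\max}+a_\alpha^{\min}}.$$
   Context: Let $\mathbf A\in\mathbb R^{N\times N}$ be symmetric positive-definite (SPD). Let $\mathbf I_H^h\in\mathbb R^{N\times N_c}$ (prolongation) have full column rank, let $\mathbf I_h^H=(\mathbf I_H^h)^{\mathcal T}$ (restriction), let $\mathbf A_H\in\mathbb R^{N_c\times N_c}$ be SPD, and let $\mathcal P\in\mathbb R^{N\times N}$ be SPD. For $\alpha\in(0,1]$ define $$\mathbf A_\alpha=\left(\alpha\mathcal P+(1-\alpha)\mathbf I_H^h\mathbf A_H^{-1}\mathbf I_h^H\right)\mathbf A .$$ For real $c_1,c_{23}$ and an eigenvalue $a_\alpha$ of $\mathbf A_\alpha$, put $b=1+c_1-c_{23}a_\alpha$ and $$\hat r(c_1,c_{23},a_\alpha)=\tfrac12\left|b+\mathrm{sgn}(b)\sqrt{b^2-4c_1}\right|,$$ where $\mathrm{sgn}(b)=1$ for $b\ge0$ and $-1$ for $b<0$, the square root of a negative number is taken to be imaginary, and $|\cdot|$ is the complex modulus. Define $\bar r(c_1,c_{23})=\max_{a_\alpha}\hat r(c_1,c_{23},a_\alpha)$, the maximum being over all eigenvalues $a_\alpha$ of $\mathbf A_\alpha$. *)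

(* Defs.v *)
From HB Require Import structures.
From mathcomp Require Import all_boot all_order all_algebra.
From mathcomp Require Import polyrcf complex reals.

Set Implicit Arguments.
Unset Strict Implicit.
Unset Printing Implicit Defensive.

Import Order.TTheory GRing.Theory Num.Theory.
Local Open Scope ring_scope.
Local Open Scope complex_scope.

Definition spd (R : realType) n (M : 'M[R]_n) : Prop :=
  M^T = M /\ forall x : 'cV[R]_n, x != 0 -> 0 < (x^T *m M *m x) 0 0.

(* [I] is the prolongation; the restriction is its transpose. *)
Definition A_alpha (R : realType) N Nc (A P : 'M[R]_N) (I : 'M[R]_(N, Nc))
    (AH : 'M[R]_Nc) (alpha : R) : 'M[R]_N :=
  (alpha *: P + (1 - alpha) *: (I *m invmx AH *m I^T)) *m A.

Definition complex_eigenvalue (R : realType) n (M : 'M[R]_n) (z : R[i]) : bool :=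
  eigenvalue (map_mx (real_complex R) M) z.

Definition smallest_eigenvalue (R : realType) n (M : 'M[R]_n) (m : R) : Prop :=
  eigenvalue M m /\ forall a, eigenvalue M a -> m <= a.

Definition largest_eigenvalue (R : realType) n (M : 'M[R]_n) (m : R) : Prop :=
  eigenvalue M m /\ forall a, eigenvalue M a -> a <= m.

Definition spectrum (R : realType) n (M : 'M[R]_n) : seq R :=
  rootsR (char_poly M).

Lemma mem_spectrum (R : realType) n (M : 'M[R]_n) a :
  (a \in spectrum M) = eigenvalue M a.
Proof.
have nz : char_poly M != 0 by rewrite monic_neq0 ?char_poly_monic.
by rewrite eigenvalue_root_char /spectrum -(roots_on_rootsR nz) in_itv.
Qed.

(* Unlike [Num.sg], this is 1 at 0. *)
Definition sgn (R : realType) (b : R) : R := if 0 <= b then 1 else -1.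

(* [sqrtc] is the principal complex square root, [normc] the real-valued
   complex modulus. *)
Definition rhat (R : realType) (c1 c23 a : R) : R :=
  let b := 1 + c1 - c23 * a in
  2^-1 * ComplexField.Normc.normc (b%:C + (sgn b)%:C * sqrtc (b ^+ 2 - 4 * c1)%:C).

Lemma sqrtc_neg (R : realType) (x : R) :
  x < 0 -> sqrtc x%:C = 0 +i* Num.sqrt (- x).
Proof.
move=> x0; rewrite /sqrtc /= expr0n /= addr0 eqxx mul1r sqrtr_sqr ltr0_norm //.
have -> : - x + x = 0 by rewrite addNr.
have -> : - x - x = - x * 2 by rewrite mulr_natr mulr2n.
by rewrite mul0r sqrtr0 mulfK // pnatr_eq0.
Qed.

Lemma rhat_ge0 (R : realType) (c1 c23 a : R) : 0 <= rhat c1 c23 a.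
Proof.
rewrite mulr_ge0 ?invr_ge0 ?ler0n //.
by case: (_ + _) => u v /=; rewrite sqrtr_ge0.
Qed.

(* As [rhat] is nonnegative, the default value 0 does not affect the maximum
   when the spectrum is nonempty; see [rbarP]. *)
Definition rbar (R : realType) n (M : 'M[R]_n) (c1 c23 : R) : R :=
  \big[Num.max/0]_(a <- spectrum M) rhat c1 c23 a.

Lemma rbarP (R : realType) n (M : 'M[R]_n) (c1 c23 : R) :
  (exists a, eigenvalue M a) ->
  (exists2 a, eigenvalue M a & rbar M c1 c23 = rhat c1 c23 a) /\
  (forall a, eigenvalue M a -> rhat c1 c23 a <= rbar M c1 c23).
Proof.
move=> [a0]; rewrite -mem_spectrum => sa0.
have ub a : eigenvalue M a -> rhat c1 c23 a <= rbar M c1 c23.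
  by rewrite -mem_spectrum => sa; apply: le_bigmax_seq.
split=> //.
have : rbar M c1 c23 = 0 \/
    exists2 a, eigenvalue M a & rbar M c1 c23 = rhat c1 c23 a.
  rewrite /rbar big_seq; elim/big_ind: _ => [|x y [->|hx] [->|hy]|a].
  - by left.
  - by rewrite maxxx; left.
  - by rewrite /Num.max; case: ifP => _; [right | left].
  - by rewrite /Num.max; case: ifP => _; [left | right].
  - by rewrite /Num.max; case: ifP => _; right.
  - by rewrite mem_spectrum => ea; right; exists a.
case=> // r0; rewrite mem_spectrum in sa0; exists a0 => //.
by apply/le_anti; rewrite ub // r0 rhat_ge0.
Qed.

(* Main.v *)
(** Put B = alpha P + (1 - alpha) I A_H^-1 I^T, which is SPD. If v = x + i y is
a complex row eigenvector of B A for z = p + i q, pairing v (B A) = z v with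
B v gives  p (x B x^T + y B y^T) = (x B) A (x B)^T + (y B) A (y B)^T > 0  and
q (x B x^T + y B y^T) = 0.  For the minimization, rhat is a nondecreasing
function of |b|, so it suffices to compare the values of |b|. The function b
is affine in a and, at the proposed c23, takes opposite values at amin and
amax; for any other c23, the identity
amax b(amin) - amin b(amax) = (1 + c1) (amax - amin)  shows that |b| is at
least as large at one of the two endpoints. *)

Require Import Defs.
From mathcomp Require Import all_boot all_order all_algebra.
From mathcomp Require Import polyrcf complex reals.
From mathcomp Require Import ring lra.

Set Implicit Arguments.
Unset Strict Implicit.
Unset Printing Implicit Defensive.

Import Order.TTheory GRing.Theory Num.Theory.
Local Open Scope ring_scope.
Local Open Scope complex_scope.

Definition bform {R : realType} {n} (M : 'M[R]_n) (x y : 'rV[R]_n) : R :=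
  (x *m M *m y^T) 0 0.

Section BilinearForm.
Variables (R : realType) (n : nat) (M : 'M[R]_n).
Implicit Types x y z : 'rV[R]_n.

Lemma bformDl x y z : bform M (x + y) z = bform M x z + bform M y z.
Proof. by rewrite /bform !mulmxDl mxE. Qed.

Lemma bformZl a x z : bform M (a *: x) z = a * bform M x z.
Proof. by rewrite /bform -!scalemxAl mxE. Qed.

Lemma bformC x y : M^T = M -> bform M x y = bform M y x.
Proof.
move=> MT; transitivity ((x *m M *m y^T)^T 0 0); first by rewrite mxE.
by rewrite !trmx_mul trmxK MT mulmxA.
Qed.

Lemma spd_gt0 x : spd M -> x != 0 -> 0 < bform M x x.
Proof.
by move=> [_ Mgt0] xN0; have := Mgt0 x^T; rewrite trmxK trmx_eq0; apply.
Qed.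

Lemma spd_ge0 x : spd M -> 0 <= bform M x x.
Proof.
move=> sM; have [->|xN0] := eqVneq x 0; last exact/ltW/spd_gt0.
by rewrite /bform !mul0mx mxE.
Qed.

Lemma spd_row_inj x : spd M -> x *m M = 0 -> x = 0.
Proof.
move=> sM xM; apply/eqP; apply: contraT => /(spd_gt0 sM).
by rewrite /bform xM mul0mx mxE ltxx.
Qed.

Lemma spd_unitmx : spd M -> M \in unitmx.
Proof.
by move=> sM; rewrite -row_free_unit; apply: inj_row_free => x /(spd_row_inj sM).
Qed.

End BilinearForm.

(** Since [B] is symmetric it can be moved onto [y]; this trades the non-symmetric product [B *m A]
    for the symmetric form of [A]. *)
Lemma bform_congr (R : realType) n (A B : 'M[R]_n) x y :
  B^T = B -> bform B (x *m (B *m A)) y = bform A (x *m B) (y *m B).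
Proof. by move=> BT; rewrite /bform trmx_mul BT !mulmxA. Qed.

Lemma spd_preconditioner (R : realType) N Nc (P : 'M[R]_N) (I : 'M[R]_(N, Nc))
    (AH : 'M[R]_Nc) (alpha : R) :
  spd AH -> spd P -> 0 < alpha -> alpha <= 1 ->
  spd (alpha *: P + (1 - alpha) *: (I *m invmx AH *m I^T)).
Proof.
move=> sAH sP a0 a1; have [PT Pgt0] := sP; have [HT _] := sAH.
split=> [|x xN0].
  by rewrite linearD !linearZ /= !trmx_mul trmxK trmx_inv HT PT mulmxA.
rewrite mulmxDr mulmxDl mxE -!scalemxAr -!scalemxAl.
rewrite [X in X + _]mxE [X in _ + X]mxE.
apply: ltr_wpDr; last by rewrite mulr_gt0 ?Pgt0.
apply: mulr_ge0; first by rewrite subr_ge0.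
(* With w = x^T I AH^-1 the coarse term is w AH w^T, so positivity of [AH] itself suffices. It is
   only nonnegative, as w may vanish; strictness comes from [P] and alpha > 0. *)
have := spd_ge0 (x^T *m I *m invmx AH) sAH.
by rewrite /bform mulmxKV ?spd_unitmx // !trmx_mul trmxK trmx_inv HT !mulmxA.
Qed.

Section RealImaginaryParts.
Variables (R : realType) (n : nat).
Implicit Types (v : 'rV[R[i]]_n) (M : 'M[R]_n).

Lemma map_Re_mulmx v M :
  map_mx (@complex.Re R) (v *m map_mx (real_complex R) M)
  = map_mx (@complex.Re R) v *m M.
Proof.
apply/rowP => j; rewrite !mxE.
rewrite (big_morph (@complex.Re R) (id1 := 0) (op1 := +%R)) //; last first.
  by move=> [a b] [c d].
apply: eq_bigr => k _; rewrite !mxE; case: (v 0 k) => a b /=.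
by rewrite mulr0 subr0.
Qed.

Lemma map_Im_mulmx v M :
  map_mx (@complex.Im R) (v *m map_mx (real_complex R) M)
  = map_mx (@complex.Im R) v *m M.
Proof.
apply/rowP => j; rewrite !mxE.
rewrite (big_morph (@complex.Im R) (id1 := 0) (op1 := +%R)) //; last first.
  by move=> [a b] [c d].
apply: eq_bigr => k _; rewrite !mxE; case: (v 0 k) => a b /=.
by rewrite mulr0 add0r.
Qed.

End RealImaginaryParts.

Lemma complex_eigenvalue_mul_spd (R : realType) n (A B : 'M[R]_n) (z : R[i]) :
  spd A -> spd B -> complex_eigenvalue (B *m A) z ->
  exists2 a : R, 0 < a & z = a%:C.
Proof.
move=> sA sB /eigenvalueP[v vM vN0]; case: z vM => p q vM.
set x := map_mx (@complex.Re R) v; set y := map_mx (@complex.Im R) v.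
have xM : x *m (B *m A) = p *: x + (- q) *: y.
  by rewrite -map_Re_mulmx vM; apply/rowP => j; rewrite !mxE; case: (v 0 j) => a b /=; ring.
have yM : y *m (B *m A) = p *: y + q *: x.
  by rewrite -map_Im_mulmx vM; apply/rowP => j; rewrite !mxE; case: (v 0 j) => a b /=; ring.
have xyN0 : (x != 0) || (y != 0).
  rewrite -negb_and; apply: contra vN0 => /andP[/eqP/rowP x0 /eqP/rowP y0].
  apply/eqP/rowP => j; move: (x0 j) (y0 j); rewrite !mxE.
  by case: (v 0 j) => a b /= -> ->.
have [[AT _] [BT _]] := (sA, sB).
(* The map [f] lets one argument serve both [B] at x, y and [A] at x B, y B, the latter by
   injectivity of [B]. *)
have sum_gt0 (C : 'M[R]_n) f : spd C -> (forall u, u != 0 -> f u != 0) ->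
    0 < bform C (f x) (f x) + bform C (f y) (f y).
  move=> sC fN0; case/orP: xyN0 => /fN0 /(spd_gt0 sC).
    by move/ltr_wpDr; apply; apply: spd_ge0.
  by move/ltr_wpDl; apply; apply: spd_ge0.
have Bgt0 := sum_gt0 B id sB (fun _ => id).
have Agt0 : 0 < bform A (x *m B) (x *m B) + bform A (y *m B) (y *m B).
  apply: (sum_gt0 A (mulmx^~ B)) => // u; apply: contra_neq.
  exact: spd_row_inj.
have bC := bformC x y BT.
have Exx := bform_congr A x x BT; have Eyy := bform_congr A y y BT.
have Exy := bform_congr A x y BT; have Eyx := bform_congr A y x BT.
move: Exx Eyy Exy Eyx; rewrite xM yM !bformDl !bformZl -bC.
rewrite (bformC (y *m B)) // => Exx Eyy Exy Eyx.
have pE : p * (bform B x x + bform B y y) =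
    bform A (x *m B) (x *m B) + bform A (y *m B) (y *m B).
  by rewrite -Exx -Eyy; ring.
(* Both mixed pairings equal the form of [A] at x B, y B, by symmetry of [A]; subtracting them
   cancels the terms in p. *)
have qE : q * (bform B x x + bform B y y) = 0.
  by apply/eqP; rewrite mulrDr addrC -subr_eq0; apply/eqP; move: Exy Eyx; lra.
exists p; first by rewrite -(pmulr_lgt0 _ Bgt0) pE.
by move/eqP: qE; rewrite mulf_eq0 (gt_eqF Bgt0) orbF => /eqP ->.
Qed.

Section ConvergenceFactor.
Variable R : realType.
Implicit Types c a b : R.

(** The quantity is the modulus of a root of t^2 - b t + c1. For a negative discriminant the roots
    are conjugate with product c1; otherwise [sgn] gives both summands the same sign, so their
    absolute values add. *)
Lemma rhatE c1 c a (b := 1 + c1 - c * a) :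
  rhat c1 c a = if b ^+ 2 < 4 * c1 then Num.sqrt c1
                  else 2^-1 * (`|b| + Num.sqrt (b ^+ 2 - 4 * c1)).
Proof.
rewrite /rhat -/b; case: ltP => [blt|ble].
  rewrite sqrtc_neg ?subr_lt0 //= /sgn.
  have d0 : 0 <= - (b ^+ 2 - 4 * c1) by lra.
  have sE : (if 0 <= b then 1 else -1 : R) ^+ 2 = 1.
    by case: ifP; rewrite ?sqrrN expr1n.
  set s := if _ then _ else _ in sE *.
  have -> : (b + (s * 0 - 0 * Num.sqrt (- (b ^+ 2 - 4 * c1)))) ^+ 2 +
     (0 + (s * Num.sqrt (- (b ^+ 2 - 4 * c1)) + 0 * 0)) ^+ 2 = 2 ^+ 2 * c1.
    rewrite !(mulr0, mul0r, subr0, add0r, addr0) exprMn sE sqr_sqrtr //; ring.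
  by rewrite sqrtrM ?sqr_ge0 // sqrtr_sqr normr_nat mulKf ?pnatr_eq0.
rewrite sqrtc_sqrtr ?lecR ?subr_ge0 //= !(mulr0, mul0r, subr0, add0r, addr0).
rewrite expr0n addr0 sqrtr_sqr /sgn; congr (_ * _).
have s0 := sqrtr_ge0 (b ^+ 2 - 4 * c1).
case: (leP 0 b) => b0; first by rewrite mul1r !ger0_norm // addr_ge0.
by rewrite ltr0_norm ?(ltr0_norm b0) ?mulN1r; lra.
Qed.

Lemma rhat_mono c1 c d a a' :
  `|1 + c1 - c * a| <= `|1 + c1 - d * a'| ->
  rhat c1 c a <= rhat c1 d a'.
Proof.
rewrite !rhatE; move: (1 + c1 - _) (1 + c1 - _) => b' b bb'.
have bb2 : b ^+ 2 <= b' ^+ 2.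
  by rewrite -(real_normK (num_real b)) -(real_normK (num_real b')) lerXn2r ?nnegrE.
case: (ltP (b ^+ 2)) => [blt|ble]; case: (ltP (b' ^+ 2)) => [b'lt|b'le] //.
(* Crossing from the constant branch to the other: b'^2 >= 4 c1 gives |b'| / 2 >= sqrt c1. The
   opposite crossing, treated next, contradicts [bb2]. *)
- have s0 := sqrtr_ge0 (b' ^+ 2 - 4 * c1).
  have c1ge0 : 0 <= c1 by have := sqr_ge0 b; lra.
  have : 2 * Num.sqrt c1 <= `|b'|.
    rewrite -(ler_pXn2r (n := 2)) ?nnegrE ?mulr_ge0 ?sqrtr_ge0 //.
    by rewrite exprMn sqr_sqrtr // real_normK ?num_real // -natrX.
  lra.
- lra.
- by rewrite ler_pM2l ?invr_gt0 // lerD // ler_wsqrtr // lerB.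
Qed.

End ConvergenceFactor.

Section Equioscillation.
Variables (R : realType) (m M k : R).
Hypotheses (m0 : 0 < m) (mM : m <= M).

Let s0 : 0 < M + m.
Proof. by rewrite addr_gt0 // (lt_le_trans m0). Qed.

(** For this slope the affine function is k (M + m - 2 a) / (M + m), and |M + m - 2 a| <= M - m on
    the interval. *)
Lemma equioscillation_bound a : m <= a -> a <= M ->
  `|k - 2 * k / (M + m) * a| <= `|k| * ((M - m) / (M + m)).
Proof.
move=> ma aM.
have -> : k - 2 * k / (M + m) * a = k * ((M + m - 2 * a) / (M + m)).
  by field; rewrite gt_eqF.
rewrite normrM ler_wpM2l // normrM normfV (gtr0_norm s0).
by rewrite ler_pM2r ?invr_gt0 // ler_norml; lra.
Qed.

(** Weighting the endpoint values by [M] and [m] eliminates [c]. As the weights sum to [M + m], two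
    values below the bound would make the weighted sum of moduli less than |k| (M - m). *)
Lemma equioscillation_optimal c :
  (`|k| * ((M - m) / (M + m)) <= `|k - c * m|) \/
  (`|k| * ((M - m) / (M + m)) <= `|k - c * M|).
Proof.
apply/orP; rewrite mulrA !ler_pdivrMr //.
case: leP => //= h1; rewrite leNgt; apply/negP => h2.
have : `|k| * (M - m) <= M * `|k - c * m| + m * `|k - c * M|.
  rewrite -[X in _ * X]ger0_norm ?subr_ge0 // -normrM.
  have -> : k * (M - m) = M * (k - c * m) - m * (k - c * M) by ring.
  apply: le_trans (ler_normB _ _) _; rewrite !normrM.
  by rewrite (gtr0_norm m0) (gtr0_norm (lt_le_trans m0 mM)).
rewrite -(ltr_pM2l (lt_le_trans m0 mM)) in h1.
rewrite -(ltr_pM2l m0) in h2.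
by rewrite -(ler_pM2r s0); lra.
Qed.

End Equioscillation.

Theorem lemma3p4 (R : realType) (N Nc : nat) (A P : 'M[R]_N)
    (I : 'M[R]_(N, Nc)) (AH : 'M[R]_Nc) (alpha : R)
    (hA : spd A) (hI : \rank I = Nc) (hAH : spd AH) (hP : spd P)
    (halpha0 : 0 < alpha) (halpha1 : alpha <= 1) :
  (forall z : R[i], complex_eigenvalue (A_alpha A P I AH alpha) z ->
     exists2 a : R, 0 < a & z = a%:C) /\
  (forall amin amax : R,
     smallest_eigenvalue (A_alpha A P I AH alpha) amin ->
     largest_eigenvalue (A_alpha A P I AH alpha) amax ->
     forall c1 c23 : R,
       rbar (A_alpha A P I AH alpha) c1 (2 * (1 + c1) / (amax + amin)) <=
       rbar (A_alpha A P I AH alpha) c1 c23).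
Proof.
have pos z : complex_eigenvalue (A_alpha A P I AH alpha) z ->
    exists2 a : R, 0 < a & z = a%:C.
  by apply: complex_eigenvalue_mul_spd => //; apply: spd_preconditioner.
split=> // m M [em lem] [eM leM] c1 c23.
have m0 : 0 < m.
  (* Positivity is known for complex eigenvalues, so [m] is first embedded in the complex
     numbers. *)
  have [|a a0 [->] //] := pos m%:C.
  by rewrite /complex_eigenvalue eigenvalue_map.
have mM : m <= M by apply: lem.
have ex : exists a, eigenvalue (A_alpha A P I AH alpha) a by exists m.
(* The maximum at the proposed parameter is attained at some eigenvalue [a], which lies between [m]
   and [M]; it is compared with the value for [c23] at one endpoint, itself an eigenvalue. *)
have [[a ea ->] _] := rbarP c1 (2 * (1 + c1) / (M + m)) ex.
have [_ ub] := rbarP c1 c23 ex.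
have bound := equioscillation_bound (1 + c1) m0 mM (lem _ ea) (leM _ ea).
case: (equioscillation_optimal (1 + c1) m0 mM c23) => opt.
- by apply: le_trans (ub _ em); apply: rhat_mono; apply: le_trans opt.
- by apply: le_trans (ub _ eM); apply: rhat_mono; apply: le_trans opt.
Qed.
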